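(* The class of van Rees loops $(Q,\cdot)$ forms a variety of magmas with neutral element, defined by the identities $$x(x(xy)) = y,$$ $$((xy)y)y = x,$$ $$x(y(y(xz))) = y(x(x(yz))),$$ $$(((xy)z)z)y = (((xz)y)y)z .$$ That is, a magma $(Q,\cdot)$ with a (two-sided) neutral element is a van Rees loop if and only if it satisfies these four identities.
   Context: A magma is a set with a single binary operation. A quasigroup is a magma in which all left translations $y\mapsto xy$ and right translations $y\mapsto yx$ are bijections; a loop is a quasigroup with a two-sided neutral element $\varepsilon$. Quasigroups $(Q,\cdot)$ and $(P,\circ)$ are isotopic if there are bijections $\alpha,\beta,\gamma:Q\to P$ with $\alpha(x)\circ\beta(y)=\gamma(x\cdot y)$ for all $x,y$. A loop has exponent $3$ if it satisfies $xx\cdot x=x\cdot xx=\varepsilon$ for all $x$. A van Rees loop is a loop $Q$ such that every loop isotopic to $Q$ has exponent $3$. *)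

(* Defs.v *)
From mathcomp Require Import all_boot.

Set Implicit Arguments.
Unset Strict Implicit.
Unset Printing Implicit Defensive.

(* The carrier is an arbitrary, possibly infinite, type without decidable
   equality or choice, which is why the magmas of mathcomp's monoid.v (built
   on choiceType) are not used. Bundling the carrier also keeps a loop and all
   of its isotopes in a single universe. *)
Record magma := Magma {
  carrier :> Type;
  op : carrier -> carrier -> carrier
}.

Declare Scope magma_scope.
Delimit Scope magma_scope with M.
Notation "x * y" := (op x y) : magma_scope.
Local Open Scope magma_scope.

Definition neutral (Q : magma) (e : Q) : Prop :=
  left_id e (@op Q) /\ right_id e (@op Q).

Definition is_quasigroup (Q : magma) : Prop :=
  (forall x : Q, bijective (fun y : Q => x * y)) /\
  (forall x : Q, bijective (fun y : Q => y * x)).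

Definition is_loop (Q : magma) (e : Q) : Prop :=
  is_quasigroup Q /\ neutral e.

Definition isotopic (Q P : magma) : Prop :=
  exists alpha beta gamma : Q -> P,
    [/\ bijective alpha, bijective beta, bijective gamma
      & forall x y : Q, alpha x * beta y = gamma (x * y)].

Definition exponent3 (Q : magma) (e : Q) : Prop :=
  forall x : Q, (x * x) * x = e /\ x * (x * x) = e.

Definition van_Rees_loop (Q : magma) : Prop :=
  (exists e : Q, is_loop e) /\
  (forall (P : magma) (e : P), is_loop e -> isotopic Q P -> exponent3 e).

(* Main.v *)
Require Import Defs.
From mathcomp Require Import all_boot.

Local Open Scope magma_scope.

(** Every loop isotopic to [Q] is, up to isomorphism, a principal isotope
    [x o y = (x / f) (g \ y)], with neutral element [g f]. Writing an element
    [x] of it as [x = a f = g b], exponent 3 says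
    [((a b) / f) b = g f = a (g \ (a b))]. The cases [g = e] and [f = e] are the
    first two identities, which express the divisions by products:
    [g \ y = g (g y)] and [x / f = (x f) f]. Eliminating [f = a \ (g b)], resp.
    [g = (a f) / b], then turns the general case into the last two. *)

Lemma isotope_exponent3 (Q : magma) (f g a b : Q) :
  is_quasigroup Q ->
  (forall (P : magma) (p : P), is_loop p -> isotopic Q P -> exponent3 p) ->
  a * f = g * b ->
  (exists2 c, c * f = a * b & c * b = g * f) /\
  (exists2 c, g * c = a * b & a * c = g * f).
Proof.
move=> [bijL bijR] exp3 afgb.
have [rf rfK rfK'] := bijR f; have [lg lgK lgK'] := bijL g.
have bij_rf : bijective rf by exists (fun y => y * f).
have bij_lg : bijective lg by exists (fun y => g * y).
pose P := @Defs.Magma Q (fun x y => rf x * lg y).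
have loopP : @is_loop P (g * f).
  split; split=> x.
  - exact: bij_comp (bijL (rf x)) bij_lg.
  - exact: bij_comp (bijR (lg x)) bij_rf.
  - by rewrite /= rfK lgK'.
  - by rewrite /= lgK rfK'.
have isoP : isotopic Q P.
  exists (fun x => x * f), (fun y => g * y), id.
  split=> [|||x y]; [exact: bijR | exact: bijL | by exists id |].
  by rewrite /= rfK lgK.
(* As a left factor in [P] the element [a * f = g * b] contributes [a], as a right factor [b]; so
   its square is [a * b]. *)
have [] := exp3 P _ loopP isoP (a * f).
rewrite /= rfK afgb lgK => eqR eqL.
by split; [exists (rf (a * b)) | exists (lg (a * b))].
Qed.

Lemma van_Rees_identities (Q : magma) (e : Q) :
  neutral e -> van_Rees_loop Q ->
  [/\ forall x y : Q, x * (x * (x * y)) = y,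
      forall x y : Q, ((x * y) * y) * y = x,
      forall x y z : Q, x * (y * (y * (x * z))) = y * (x * (x * (y * z)))
    & forall x y z : Q,
        (((x * y) * z) * z) * y = (((x * z) * y) * y) * z].
Proof.
move=> [mul1 mul_1] [[_ [quasiQ _]] exp3].
have key (f g a b : Q) := @isotope_exponent3 Q f g a b quasiQ exp3.
have L3 (x y : Q) : x * (x * (x * y)) = y.
  have [|_ [c]] := key y e x (x * y); first by rewrite mul1.
  by rewrite !mul1 => ->.
have R3 (x y : Q) : ((x * y) * y) * y = x.
  have [|[c]] := key e x (x * y) y; first by rewrite mul_1.
  by rewrite !mul_1 => ->.
split=> // x y z.
  (* The first argument is the [f] solving [x * f = y * z]. Since [y * c = x * z], [L3] also gives
     [c] as [y * (y * (x * z))]. *)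
  have [|_ [c yc xc]] := key (x * (x * (y * z))) y x z; first exact: L3.
  by rewrite -yc L3.
(* Dually, the second argument is the [g] solving [g * y = x * z]. *)
have [|[c cz cy] _] := key z (((x * z) * y) * y) x y; first by rewrite R3.
by rewrite -cz R3.
Qed.

Lemma identities_van_Rees (Q : magma) (e : Q) :
  neutral e ->
  (forall x y : Q, x * (x * (x * y)) = y) ->
  (forall x y : Q, ((x * y) * y) * y = x) ->
  (forall x y z : Q, x * (y * (y * (x * z))) = y * (x * (x * (y * z)))) ->
  (forall x y z : Q, (((x * y) * z) * z) * y = (((x * z) * y) * y) * z) ->
  van_Rees_loop Q.
Proof.
move=> neu L3 R3 L4 R4; split.
  exists e; split=> //; split=> x.
    by exists (fun y => x * (x * y)) => y; rewrite L3.
  by exists (fun y => (y * x) * x) => y; rewrite R3.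
move=> P p [_ [mul1 mul_1]] [alpha] [beta] [gamma].
move=> [[alpha' _ alphaK] [beta' _ betaK] /bij_inj gammaI iso] q.
(* Pulling [p] back along [beta] and [alpha] expresses both maps through [gamma], which becomes an
   isomorphism onto [P] from the principal isotope given by [f] and [g]. *)
set f := beta' p; set g := alpha' p.
have alphaE x : alpha x = gamma (x * f) by rewrite -iso betaK mul_1.
have betaE x : beta x = gamma (g * x) by rewrite -iso alphaK mul1.
have gfE : gamma (g * f) = p by rewrite -betaE betaK.
have gammaL x : gamma x = alpha ((x * f) * f) by rewrite alphaE R3.
have gammaR x : gamma x = beta (g * (g * x)) by rewrite betaE L3.
set a := alpha' q; set b := beta' q.
have qa : q = alpha a by rewrite alphaK.
have qb : q = beta b by rewrite betaK.
have afgb : a * f = g * b by apply: gammaI; rewrite -alphaE -betaE -qa.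
have qq : q * q = gamma (a * b) by rewrite {1}qa qb iso.
split; rewrite qq.
  (* [R4] brings [f] next to [a]; replacing [a * f] by [g * b] lets [R3] cancel three factors [b],
     leaving [g * f]. *)
  by rewrite gammaL qb iso R4 afgb R3.
by rewrite gammaR qa iso L4 -afgb L3.
Qed.

Theorem theorem3 (Q : magma) (e : Q) (he : neutral e) :
  van_Rees_loop Q <->
  [/\ forall x y : Q, x * (x * (x * y)) = y,
      forall x y : Q, ((x * y) * y) * y = x,
      forall x y z : Q, x * (y * (y * (x * z))) = y * (x * (x * (y * z)))
    & forall x y z : Q,
        (((x * y) * z) * z) * y = (((x * z) * y) * y) * z].
Proof.
split; first exact: van_Rees_identities he.
by case=> L3 R3 L4 R4; apply: identities_van_Rees he L3 R3 L4 R4.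
Qed.
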